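(* Let $(e_n)$ be a bounded Markushevich basis for a Banach space $X$. Then the following assertions are equivalent: (a) $(e_n)$ is almost greedy. (b) For every $0\le\lambda<1$ there exists a constant $C$ such that for any $x\in X$, $m\in\mathbb{N}$, any $A\subset\mathbb{N}$ with $|A|\le m$ and $|A\cap\Lambda_m(x)|\le\lambda m$, and any $a_i\in\mathbb{R}$, $i\in A$, we have $$\|x-G_m(x)\|\le C\Big\|x-\sum_{i\in A}a_ie_i\Big\|.$$
   Context: $X$ is a real Banach space (possibly finite-dimensional; if $\dim X=N<\infty$, all indices and index sets lie in $\{1,\dots,N\}$ instead of $\mathbb{N}$, and $m\le N$). $(e_n)$ with biorthogonal functionals $(e_n^* )$ is a bounded Markushevich basis if $((e_n),(e_n^* ))$ is a biorthogonal system such that $a<\|e_n\|,\|e_n^*\|<b$ for some positive constants $a,b$, the linear span of $(e_n)$ is dense in $X$, and the map $x\mapsto(e_n^*(x))$ is injective. $\mathrm{supp}(x)=\{n: e_n^*(x)\ne0\}$; for an index set $A$, $|A|$ is its cardinality and, for finite $A$, $P_A(x)=\sum_{i\in A}e_i^*(x)e_i$. Greedy approximation: a greedy ordering for $x\in X$ is an injective map $\rho$ from the index set into itself with $\mathrm{supp}(x)$ contained in the range of $\rho$ and $|e_{\rho(j)}^*(x)|\ge|e_{\rho(k)}^*(x)|$ whenever $j<k$. Put $\Lambda_m(x)=\{\rho(1),\dots,\rho(m)\}$ and $G_m(x)=\sum_{n\in\Lambda_m(x)}e_n^*(x)e_n$. Statements involving $G_m(x)$, $\Lambda_m(x)$ are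 meant for any greedy ordering of $x$ (the same ordering throughout the statement). Definition: $(e_n)$ is almost greedy if there is $C$ with $\|x-G_m(x)\|\le C\inf\{\|x-P_A(x)\| : |A|\le m\}$ for all $x\in X$, $m\in\mathbb{N}$. *)

(* Defs.v *)
From HB Require Import structures.
From mathcomp Require Import all_boot all_order all_algebra.
From mathcomp Require Import finmap.
From mathcomp Require Import all_classical all_reals all_analysis.
Import Order.TTheory GRing.Theory Num.Theory.
Import numFieldNormedType.Exports.

Set Implicit Arguments.
Unset Strict Implicit.
Unset Printing Implicit Defensive.

Local Open Scope classical_set_scope.
Local Open Scope ring_scope.

(* Indices start at 1. The index set is either {1, 2, ...} or {1, ..., N}. For
   a Markushevich basis indexed by D, the second case holds exactly when X is
   finite-dimensional, and then N = dim X. The families below are functions on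
   all of nat, and only their values on D matter. For m : nat, [D m] expresses
   "1 <= m", together with "m <= N" in the finite case. *)
Definition index_set (D : set nat) : Prop :=
  D = [set n | (1 <= n)%N] \/ exists N : nat, D = [set n | (1 <= n <= N)%N].

Section Bases.
Variables (R : realType) (X : completeNormedModType R).
Variables (D : set nat) (e : nat -> X) (es : nat -> {linear X -> R^o}).

(* Only meaningful for continuous f: for unbounded f, [sup] is 0. *)
Definition dual_norm (f : {linear X -> R^o}) : R :=
  sup [set `|f x| | x in [set x : X | `|x| <= 1]].

Definition biorthogonal : Prop :=
  (forall n, D n -> continuous (es n)) /\
  (forall i j, D i -> D j -> es i (e j) = (i == j)%:R).

Definition linear_span : set X :=
  [set y | exists (A : {fset nat}) (a : nat -> R),
     [set` A] `<=` D /\ y = \sum_(i <- A) a i *: e i].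

Definition bounded_markushevich_basis : Prop :=
  [/\ biorthogonal,
      exists a b : R, [/\ 0 < a, 0 < b &
        forall n, D n -> a < `|e n| < b /\ a < dual_norm (es n) < b],
      dense linear_span &
      forall x y : X, (forall n, D n -> es n x = es n y) -> x = y].

Definition supp (x : X) : set nat := [set n | D n /\ es n x != 0].

Definition proj (A : {fset nat}) (x : X) : X := \sum_(i <- A) es i x *: e i.

Definition greedy_ordering (x : X) (rho : nat -> nat) : Prop :=
  [/\ set_fun D D rho, set_inj D rho, supp x `<=` rho @` D &
      forall j k, D j -> D k -> (j < k)%N ->
        `|es (rho k) x| <= `|es (rho j) x|].

Definition Lambda (rho : nat -> nat) (m : nat) : {fset nat} :=
  [fset rho j | j in iota 1 m]%fset.

Definition greedy_approx (rho : nat -> nat) (m : nat) (x : X) : X :=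
  proj (Lambda rho m) x.

Definition almost_greedy : Prop :=
  exists C : R, forall (x : X) (rho : nat -> nat), greedy_ordering x rho ->
    forall m : nat, D m ->
      `|x - greedy_approx rho m x| <=
      C * inf [set `|x - proj A x| | A in
                 [set A : {fset nat} | [set` A] `<=` D /\ (#|` A| <= m)%N]].

End Bases.

(* Main.v *)
(* Both conditions depend on a greedy ordering only through the finite greedy
   sets S of x: those with |x_j| <= |x_i| for i in S and j outside S.

   (b) => (a): apply (b) with lambda = 0 to y = x - P_{A n S} x, its greedy set
   S \ A and the set A \ S.

   (a) => (b): let z = x - sum_{i in A} a_i e_i, let t be the least |x_i| on S
   and B = (S \ A) u {i in A : |z_i| >= t}, a greedy set of z. Then
     x - P_S x = (z - P_B z) - P_{A \ B} z + P_{A \ S} x.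
   The first term is at most C |z|. The other two have coefficients at most t
   and at most m <= |B| / (1 - lambda) terms. Applying (a) to
   sum_{i in B} b_i e_i + sum_{i in F} c_i e_i, with B and F disjoint,
   |F| <= |B| and |c| <= t <= |b|, bounds the F-part by C times the B-part, so
   such sums are controlled by |P_B z|, hence by |z|. *)
Require Import Defs.
From HB Require Import structures.
From mathcomp Require Import all_boot all_order all_algebra.
From mathcomp Require Import finmap.
From mathcomp Require Import all_classical all_reals all_analysis.
From mathcomp Require Import zify.
Import Order.TTheory GRing.Theory Num.Theory.
Import numFieldNormedType.Exports.

Set Implicit Arguments.
Unset Strict Implicit.
Unset Printing Implicit Defensive.

Local Open Scope classical_set_scope.
Local Open Scope ring_scope.

(** * Sums over finite sets and their heaviest subsets *)

Lemma sum_fsetID (V : zmodType) (K : choiceType) (A B : {fset K}) (F : K -> V) :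
  \sum_(i <- A) F i =
  \sum_(i <- (A `&` B)%fset) F i + \sum_(i <- (A `\` B)%fset) F i.
Proof.
rewrite (big_fsetID _ (mem B) A); congr (_ + _); apply: eq_fbigl => i.
  by rewrite !inE.
by rewrite !inE andbC.
Qed.

Lemma fset_argmax (R : realDomainType) (K : choiceType) (w : K -> R)
    (A : {fset K}) : A != fset0 ->
  exists2 i, i \in A & forall j, j \in A -> w j <= w i.
Proof.
elim/finSet_rect: A => A IH A0.
have [i iA] := fset0Pn _ A0.
have [A1|A1] := eqVneq (A `\ i)%fset fset0.
  exists i => // j jA; suff -> : j = i by [].
  by apply/eqP; apply: contraT => ji; have : j \in (A `\ i)%fset;
    [rewrite !inE ji jA | rewrite A1 inE].
have [k] := IH _ (fproperD1 iA) A1; rewrite !inE => /andP[ki kA] kmax.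
have [ik|/ltW ki'] := leP (w i) (w k).
  exists k => // j jA; have [->//|ji] := eqVneq j i.
  by apply: kmax; rewrite !inE ji.
exists i => // j jA; have [->//|ji] := eqVneq j i.
by apply: le_trans ki'; apply: kmax; rewrite !inE ji.
Qed.

(** Adjoin a maximiser of the rest, one at a time. This serves to halve a greedy set by coefficient
    size and, with constant weights, to extract a subset of given size. *)
Lemma fset_largest (R : realDomainType) (K : choiceType) (w : K -> R)
    (B : {fset K}) (n : nat) : (n <= #|` B|)%N ->
  exists S : {fset K}, [/\ (S `<=` B)%fset, #|` S| = n &
    forall i j, i \in S -> j \in B -> j \notin S -> w j <= w i].
Proof.
elim: n => [_|n IH nB].
  by exists fset0; split; rewrite ?fsub0set ?cardfs0// => i j; rewrite inE.
have [S [SB Sn Smax]] := IH (ltnW nB).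
have BS0 : (B `\` S)%fset != fset0.
  by rewrite -cardfs_gt0 cardfsDS// Sn subn_gt0.
have [k] := fset_argmax w BS0; rewrite inE => /andP[kS kB] kmax.
exists (k |` S)%fset; split.
- by rewrite fsubUset fsub1set kB.
- by rewrite cardfsU1 kS Sn.
- move=> i j; rewrite !inE negb_or => /orP[/eqP->|iS] jB /andP[jk jS].
    by apply: kmax; rewrite inE jS.
  exact: Smax.
Qed.

(** * Listing an index set by decreasing weight *)

Section WeightOrdering.
Variables (R : realType) (D : set nat).
Hypothesis hD : index_set D.

Lemma index_setS n k : D n -> (0 < k <= n)%N -> D k.
Proof. by case: hD => [->|[N ->]] /=; lia. Qed.

Lemma index_set_gt0 n : D n -> (0 < n)%N.
Proof. by case: hD => [->|[N ->]] /=; lia. Qed.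

Lemma index_set_subset_card (F : {fset nat}) : [set` F] `<=` D ->
  F != fset0 -> D #|` F|.
Proof.
rewrite -cardfs_gt0; case: hD => [->|[N ->]] //= FD ->/=.
have -> : N = #|` [fset i in iota 1 N]%fset|.
  by rewrite card_fseq undup_id ?iota_uniq// size_iota.
apply: fsubset_leq_card; apply/fsubsetP => i /FD/=.
by rewrite !inE mem_iota; lia.
Qed.

(** As [D] is an initial segment, the hypothesis says that [D] has more elements than [F];
    pigeonhole on {1, ..., |F| + 1}. *)
Lemma index_set_fresh (F : {fset nat}) : D #|` F|.+1 -> exists2 i, D i & i \notin F.
Proof.
move=> DF; apply: contrapT => nex.
have : ([fset i in iota 1 #|` F|.+1] `<=` F)%fset.
  apply/fsubsetP => i; rewrite !inE mem_iota => ilt.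
  apply: contrapT => iF; apply: nex; exists i; last exact/negP.
  by apply: index_setS DF _; lia.
move=> /fsubset_leq_card.
by rewrite card_fseq undup_id ?iota_uniq// size_iota ltnn.
Qed.

Variable w : nat -> R.
Hypothesis w0 : forall i, 0 <= w i.
Hypothesis wfin : forall eps, 0 < eps -> finite_set [set i | D i /\ eps <= w i].

(** A positive weight outside [F] is reached by only finitely many indices, so a maximum exists
    among these. Without such a weight, all remaining weights vanish and any free index will do. *)
Lemma weight_argmax (F : {fset nat}) : D #|` F|.+1 ->
  exists i, [/\ D i, i \notin F & forall j, D j -> j \notin F -> w j <= w i].
Proof.
move=> /index_set_fresh[i0 Di0 i0F].
have [wz|] := pselect (forall j, D j -> j \notin F -> w j <= 0).
  exists i0; split => // j Dj jF; exact: le_trans (wz _ Dj jF) (w0 _).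
move=> /existsNP[i1 /not_implyP[Di1 /not_implyP[i1F /negP]]]; rewrite -ltNge => wi1.
have /finite_fsetP[E EE] := wfin wi1.
have inE' i : (i \in E) = `[< D i /\ w i1 <= w i >].
  apply/idP/asboolP => [iE|h].
    by have : [set` E] i by []; rewrite -EE.
  by suff : [set` E] i by []; rewrite -EE.
have E0 : (E `\` F)%fset != fset0.
  by apply/fset0Pn; exists i1; rewrite inE i1F inE'; apply/asboolP.
have [k] := fset_argmax w E0; rewrite inE inE' => /andP[kF /asboolP[Dk wk]] kmax.
exists k; split=> // j Dj jF.
have [wj|/ltW wj] := leP (w i1) (w j); last exact: le_trans wk.
by apply: kmax; rewrite inE jF inE'; apply/asboolP.
Qed.

(** Pick at each stage a heaviest index not yet chosen. Indices of weight zero may be missed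
    forever, so only those of positive weight are claimed to be reached. *)
Lemma weight_ordering : exists rho : nat -> nat,
  [/\ set_fun D D rho, set_inj D rho,
      (forall i, D i -> 0 < w i -> exists2 j, D j & rho j = i) &
      forall j k, D j -> D k -> (j < k)%N -> w (rho k) <= w (rho j)].
Proof.
(* If [D] has at most |F| elements, the value 0 is a mere default. *)
have /choice[g gP] : forall F : {fset nat}, exists i, D #|` F|.+1 ->
    [/\ D i, i \notin F & forall j, D j -> j \notin F -> w j <= w i].
  move=> F; have [/weight_argmax[i iP]|nD] := pselect (D #|` F|.+1).
    by exists i.
  by exists 0%N.
(* [Fs n] collects the first n choices. Indices start at 1, so [rho n] is chosen outside
   [Fs n.-1]. *)
pose Fs := fix Fs n := if n is n'.+1 then (g (Fs n') |` Fs n')%fset else fset0.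
pose rho n := g (Fs n.-1).
have FsP n : (n = 0%N \/ D n) -> #|` Fs n| = n /\ [set` Fs n] `<=` D.
  elim: n => [_|n IH [//|DSn]].
    by split; [exact: cardfs0 | move=> i /=; rewrite inE].
  have [cn sn] : #|` Fs n| = n /\ [set` Fs n] `<=` D.
    by apply: IH; case: n DSn => [|n] h; [left|right; apply: index_setS h _; lia].
  have [] := gP (Fs n); rewrite ?cn// => Dg gF _.
  split=> /=; first by rewrite cardfsU1 gF cn.
  by move=> i /=; rewrite !inE => /orP[/eqP->//|/sn].
have rhoP n : D n -> [/\ D (rho n), rho n \notin Fs n.-1 &
    forall j, D j -> j \notin Fs n.-1 -> w j <= w (rho n)].
  move=> Dn; apply: gP; case: n Dn => [|n] Dn; first by have := index_set_gt0 Dn.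
  suff [-> _] : #|` Fs n| = n /\ [set` Fs n] `<=` D by [].
  by apply: FsP; case: n Dn => [|n] h; [left|right; apply: index_setS h _; lia].
have FsE n i : (i \in Fs n) <-> exists2 j, (0 < j <= n)%N & rho j = i.
  elim: n i => [|n IH] i /=.
    by rewrite inE; split => // -[j]; lia.
  rewrite !inE; split=> [/orP[/eqP->|/IH[j jn <-]]|[j jn <-]].
  - by exists n.+1; rewrite ?leqnn.
  - by exists j => //; lia.
  - have [->|jn'] := eqVneq j n.+1; first by rewrite eqxx.
    by apply/orP; right; apply/IH; exists j => //; lia.
have notF j k : D j -> D k -> (j < k)%N -> rho j \in Fs k.-1.
  by move=> /index_set_gt0 j0 Dk jk; apply/FsE; exists j => //; lia.
exists rho; split.
- by move=> n /rhoP[].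
- move=> j k; rewrite !inE => Dj Dk e.
  have [jk|kj|//] := ltngtP j k.
    by have [_ + _] := rhoP _ Dk; rewrite -e notF.
  by have [_ + _] := rhoP _ Dj; rewrite e notF.
(* If [i] were never chosen, every chosen index would weigh at least [w i], so each [Fs n] would lie
   in the finite set [E]. This fails for n = |E| + 1 when [D] is infinite; when [D] is {1, ..., N},
   already [Fs N] and [i] make N + 1 elements of [D]. *)
- move=> i Di wi; apply: contrapT => nex.
  have iF n : (n = 0%N \/ D n) -> i \notin Fs n.
    move=> hn; apply/negP => /FsE[j jn e]; apply: nex; exists j => //.
    by case: hn => [n0|Dn]; [lia | exact: index_setS Dn jn].
  have /finite_fsetP[E EE] := wfin wi.
  have FsE' n : (n = 0%N \/ D n) -> (Fs n `<=` E)%fset.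
    move=> hn; apply/fsubsetP => k /FsE[j jn <-].
    have Dj : D j by case: hn => [|Dn]; [lia | exact: index_setS Dn jn].
    suff : [set` E] (rho j) by [].
    rewrite -EE; have [Dr _ rmax] := rhoP _ Dj; split => //.
    apply: rmax => //; apply: iF.
    by case: (j) jn Dj => [|[|l]] h Dj; [lia|left|right; apply: index_setS Dj _; lia].
  case: hD => [De|[N De]].
    have Dn n : n = 0%N \/ D n by rewrite De /=; lia.
    have := fsubset_leq_card (FsE' _ (Dn #|` E|.+1)).
    by have [-> _] := FsP _ (Dn #|` E|.+1); rewrite ltnn.
  have DN : N = 0%N \/ D N by rewrite De /=; lia.
  have [cN sN] := FsP _ DN.
  have : D #|` (i |` Fs N)%fset|.
    apply: index_set_subset_card; last by apply/fset0Pn; exists i; rewrite !inE eqxx.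
    by move=> k /=; rewrite !inE => /orP[/eqP->//|/sN].
  by rewrite cardfsU1 iF// cN De /=; lia.
(* [rho k] was still available when [rho j] was chosen. *)
- move=> j k Dj Dk jk; have [Drk rk _] := rhoP _ Dk; have [_ _] := rhoP _ Dj.
  apply=> //; apply/negP => /FsE[l lj e]; move/negP: rk; apply.
  by apply/FsE; exists l => //; lia.
Qed.

End WeightOrdering.

(** * Coordinate estimates for a bounded Markushevich basis *)

Section Greedy.
Variables (R : realType) (X : completeNormedModType R) (D : set nat).
Variables (e : nat -> X) (es : nat -> {linear X -> R^o}).
Hypothesis hM : bounded_markushevich_basis D e es.

(** Ties are broken arbitrarily, so the nonempty greedy sets of x are the sets [Lambda rho m] over
    all greedy orderings; the empty set is allowed too. *)
Definition greedy_set (x : X) (S : {fset nat}) : Prop :=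
  [set` S] `<=` D /\
  forall i j, i \in S -> D j -> j \notin S -> `|es j x| <= `|es i x|.

Lemma coord_lincomb (A : {fset nat}) (a : nat -> R) (j : nat) :
  [set` A] `<=` D -> D j ->
  es j (\sum_(i <- A) a i *: e i) = if j \in A then a j else 0.
Proof.
move=> AD Dj; have [[_ bio] _ _ _] := hM.
have coord i : i \in A -> es j (a i *: e i) = a i * (j == i)%:R.
  by move=> iA; rewrite linearZ /= bio//; exact: AD.
have -> : es j (\sum_(i <- A) a i *: e i) = \sum_(i <- A) a i * (j == i)%:R.
  by rewrite linear_sum /=; apply: eq_big_seq => i /= /coord.
case: ifPn => jA; last first.
  apply: big1_seq => i /= iA.
  by case: eqVneq => [ji|]; [rewrite ji iA in jA | rewrite mulr0].
rewrite (big_fsetD1 j)//= eqxx mulr1 big1_seq ?addr0// => i.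
by rewrite /= !inE => /andP[ij iA]; rewrite eq_sym (negbTE ij) mulr0.
Qed.

(** Continuity bounds [es n] on the unit ball, so the [sup] in [dual_norm] is a true supremum;
    normalising x does the rest. *)
Lemma basis_bounds : exists2 b : R, 0 < b &
  forall n, D n -> `|e n| <= b /\ forall x, `|es n x| <= b * `|x|.
Proof.
have [[cont _] [a [b [a0 b0 hb]]] _ _] := hM.
exists b => // n Dn; have [/andP[_ /ltW ?] /andP[_ /ltW nb]] := hb _ Dn.
split=> // x.
have ub : has_ubound [set `|es n x| | x in [set x : X | `|x| <= 1]].
  have /linear_bounded_continuous/linear_boundedP/pinfty_ex_gt0[r r0 Br] := cont _ Dn.
  exists r => _ [y /= y1 <-]; apply: le_trans (Br y) _.
  by rewrite ler_piMr// ltW.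
have unit y : `|y| <= 1 -> `|es n y| <= b.
  by move=> y1; apply: le_trans nb; apply: ub_le_sup => //; exists y.
have [->|x0] := eqVneq x 0; first by rewrite linear0 !normr0 mulr0.
have := unit (`|x|^-1 *: x).
rewrite linearZ /= !normrZ normfV normr_id mulVf ?normr_eq0// => /(_ (lexx _)).
by rewrite ler_pdivrMl ?normr_gt0// mulrC.
Qed.

(** Coordinates tend to zero: those of a finite combination y within eps / b of x differ from those
    of x by less than eps, so only the finitely many indices of y can count. *)
Lemma coord_finite (x : X) (eps : R) : 0 < eps ->
  finite_set [set i | D i /\ eps <= `|es i x|].
Proof.
move=> eps0; have [_ _ dns _] := hM; have [b b0 hb] := basis_bounds.
have [|y [xy [A [a [AD ya]]]]] := dns (ball x (eps / b)) _ (ball_open _ _).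
  by exists x; apply: ballxx; rewrite divr_gt0.
apply: (sub_finite_set _ (finite_fset A)) => i [Di hi].
apply: contrapT => /negP iA; move: hi; apply/negP; rewrite -ltNge.
have -> : es i x = es i (x - y).
  by rewrite linearB /= ya coord_lincomb// (negbTE iA) subr0.
apply: le_lt_trans (proj2 (hb _ Di) _) _.
by move: xy; rewrite -ball_normE /= ltr_pdivlMr// mulrC.
Qed.

(** * Greedy sets versus greedy orderings *)

Hypothesis hD : index_set D.

Lemma card_Lambda (rho : nat -> nat) (m : nat) :
  set_inj D rho -> D m -> #|` Lambda rho m| = m.
Proof.
move=> inj Dm; rewrite /Lambda card_in_imfset /=; last first.
  by move=> j k; rewrite !mem_iota => hj hk; apply: inj; rewrite inE;
    apply: (index_setS hD Dm); lia.
by rewrite undup_id ?iota_uniq ?size_iota.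
Qed.

(** An index outside [Lambda rho m] with nonzero coordinate is some [rho l] with l > m. *)
Lemma Lambda_greedy_set (x : X) (rho : nat -> nat) (m : nat) :
  greedy_ordering D es x rho -> D m -> greedy_set x (Lambda rho m).
Proof.
move=> [fD inj sup dec] Dm.
have Dk k : k \in iota 1 m -> D k.
  by rewrite mem_iota => hk; apply: (index_setS hD Dm); lia.
split=> [_ /= /imfsetP[k /= /Dk hk ->]|_ j /imfsetP[k /= km ->] Dj jL].
  exact: fD.
have [->|xj] := eqVneq (es j x) 0; first by rewrite normr0.
have [|l Dl lj] := sup j; first by [].
rewrite -lj; apply: dec => //; first exact: Dk.
have l0 := index_set_gt0 hD Dl.
have : l \notin iota 1 m by apply: contra jL => lm; apply/imfsetP; exists l.
by move: km; rewrite !mem_iota; lia.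
Qed.

(* Ordering by the weights [|x_i| + 1_S(i)] lists S first. *)
Lemma greedy_set_ordering (x : X) (S : {fset nat}) :
  greedy_set x S -> S != fset0 ->
  exists2 rho, greedy_ordering D es x rho & Lambda rho #|` S| = S.
Proof.
move=> [SD Smax] S0.
pose w i : R := `|es i x| + (i \in S)%:R.
have w0 i : 0 <= w i by rewrite addr_ge0.
have wS i j : i \in S -> D j -> j \notin S -> w j < w i.
  move=> iS Dj jS; rewrite /w iS (negbTE jS) addr0.
  by apply: le_lt_trans (Smax _ _ iS Dj jS) _; rewrite ltrDl.
have wfin eps : 0 < eps -> finite_set [set i | D i /\ eps <= w i].
  move=> eps0; apply: (sub_finite_set (B := [set i | D i /\ eps <= `|es i x|] `|` [set` S])).
    move=> i /= [Di]; rewrite /w; have [iS|iS] := boolP (i \in S); first by right.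
    by rewrite addr0; left.
  by rewrite finite_setU; split; [exact: coord_finite | exact: finite_fset].
have [rho [fD inj sup dec]] := weight_ordering hD w0 wfin.
have DS : D #|` S| by apply: index_set_subset_card.
exists rho; first split => //.
- move=> i [Di xi]; have [|j Dj <-] := sup _ Di; last by exists j.
  by rewrite ltr_wpDr// normr_gt0.
- move=> j k Dj Dk jk; have := dec _ _ Dj Dk jk.
  have [kS|kS] := boolP (rho k \in S); have [jS|jS] := boolP (rho j \in S).
  + by rewrite /w kS jS lerD2r.
  + by rewrite leNgt wS//; exact: fD.
  + by move=> _; apply: Smax => //; exact: fD.
  + by rewrite /w (negbTE kS) (negbTE jS) !addr0.
(* By cardinality one inclusion suffices. If [rho k] lies in S, so do all earlier values, since
   elements of S outweigh all others; hence k <= |S|. *)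
apply/esym/eqP; rewrite eqEfcard card_Lambda// leqnn andbT.
apply/fsubsetP => i iS; have [|k Dk ki] := sup i (SD _ iS).
  by rewrite /w iS ltr_wpDl.
apply/imfsetP; exists k => //=; rewrite mem_iota (index_set_gt0 hD Dk) /=.
suff /fsubset_leq_card : (Lambda rho k `<=` S)%fset by rewrite card_Lambda.
apply/fsubsetP => _ /imfsetP[j /= + ->]; rewrite mem_iota => hj.
have Dj : D j by apply: (index_setS hD Dk); lia.
have [->|jk] := eqVneq j k; first by rewrite ki.
have jk' : (j < k)%N by lia.
apply: contraT => jS; have := dec j k Dj Dk jk'.
by rewrite ki leNgt wS//; exact: fD.
Qed.

(** Trades the infimum for an arbitrary competitor A and orderings for greedy sets, the form of (a)
    used from here on. *)
Lemma almost_greedyP : almost_greedy D e es <->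
  exists2 C : R, 0 < C & forall (x : X) (S A : {fset nat}), greedy_set x S ->
    [set` A] `<=` D -> (#|` A| <= #|` S|)%N ->
    `|x - Defs.proj e es S x| <= C * `|x - Defs.proj e es A x|.
Proof.
split=> [[C hC]|[C C0 hC]].
  (* The maximum with 1 makes the constant positive and covers empty S, where A is empty too and no
     m in [D] is available. *)
  exists (Num.max C 1); first by rewrite lt_max ltr01 orbT.
  move=> x S A xS AD cA; have [S0|S0] := eqVneq S fset0.
    move: cA; rewrite S0 cardfs0 leqn0 cardfs_eq0 => /eqP->.
    by rewrite ler_peMl// le_max lexx orbT.
  have [rho xrho <-] := greedy_set_ordering xS S0.
  apply: le_trans (hC _ _ xrho _ (index_set_subset_card hD xS.1 S0)) _.
  set I := inf _.
  have I0 : 0 <= I.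
    apply: lb_le_inf; last by move=> _ [B _ <-].
    by exists `|x - Defs.proj e es A x|, A.
  apply: (@le_trans _ _ (Num.max C 1 * I)).
    by rewrite ler_wpM2r// le_max lexx.
  rewrite ler_wpM2l ?le_max ?ler01 ?orbT//.
  by apply: ge_inf; [exists 0 => _ [B _ <-] | exists A].
exists C => x rho xrho m Dm; rewrite mulrC -ler_pdivrMr//.
apply: lb_le_inf; first by exists `|x - Defs.proj e es fset0 x|, fset0; rewrite //=
  cardfs0; split => // i /=; rewrite inE.
move=> _ [A [AD cA] <-]; rewrite ler_pdivrMr// mulrC.
apply: hC => //; first exact: Lambda_greedy_set.
by have [_ inj _ _] := xrho; rewrite card_Lambda.
Qed.

End Greedy.

(** * Comparison of coefficient sums in an almost greedy basis *)

Section AlmostGreedyConsequences.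
Variables (R : realType) (X : completeNormedModType R) (D : set nat).
Variables (e : nat -> X) (es : nat -> {linear X -> R^o}).
Hypothesis hM : bounded_markushevich_basis D e es.
Variable C : R.
Hypothesis C0 : 0 < C.
Hypothesis hC : forall (x : X) (S A : {fset nat}), greedy_set D es x S ->
  [set` A] `<=` D -> (#|` A| <= #|` S|)%N ->
  `|x - Defs.proj e es S x| <= C * `|x - Defs.proj e es A x|.

Lemma greedy_remainder_le (x : X) (S : {fset nat}) :
  greedy_set D es x S -> `|x - Defs.proj e es S x| <= C * `|x|.
Proof.
move=> xS; have := hC (A := fset0) xS.
rewrite {2}/Defs.proj big_seq_fset0 subr0 cardfs0; exact.
Qed.

Lemma greedy_proj_le (x : X) (S : {fset nat}) :
  greedy_set D es x S -> `|Defs.proj e es S x| <= (C + 1) * `|x|.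
Proof.
move=> /greedy_remainder_le h.
rewrite -(subKr x (Defs.proj e es S x)) mulrDl mul1r [leRHS]addrC.
by apply: le_trans (ler_normB _ _) _; rewrite lerD2l.
Qed.

(** B is a greedy set of the sum of both combinations: removing it leaves the F-part, while removing
    F leaves the B-part. *)
Lemma disjoint_lincomb_le (B F : {fset nat}) (b c : nat -> R) (t : R) :
  0 <= t -> [set` B] `<=` D -> [set` F] `<=` D -> (forall i, i \in F -> i \notin B) ->
  (#|` F| <= #|` B|)%N ->
  (forall i, i \in B -> t <= `|b i|) -> (forall i, i \in F -> `|c i| <= t) ->
  `|\sum_(i <- F) c i *: e i| <= C * `|\sum_(i <- B) b i *: e i|.
Proof.
move=> t0 BD FD dis card bt ct.
pose u := \sum_(i <- B) b i *: e i; pose v := \sum_(i <- F) c i *: e i.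
have coord j : D j -> es j (u + v) =
    (if j \in B then b j else 0) + (if j \in F then c j else 0).
  by move=> Dj; rewrite linearD /= !(coord_lincomb hM).
have disB i : i \in B -> i \notin F by apply: contraL; exact: dis.
have pB : Defs.proj e es B (u + v) = u.
  apply: eq_big_seq => i /= iB.
  by rewrite coord; [rewrite iB (negbTE (disB _ iB)) addr0 | exact: BD].
have pF : Defs.proj e es F (u + v) = v.
  apply: eq_big_seq => i /= iF.
  by rewrite coord; [rewrite iF (negbTE (dis _ iF)) add0r | exact: FD].
have gB : greedy_set D es (u + v) B.
  split=> // i j iB Dj jB; rewrite !coord//; last exact: BD.
  rewrite iB (negbTE jB) (negbTE (disB _ iB)) addr0 add0r.
  apply: le_trans (bt _ iB); case: ifPn => [/ct//|jF].
  by rewrite normr0.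
have := hC gB FD card.
by rewrite pB pF addrK [u + v]addrC addrK.
Qed.

(** Cut F into at most k blocks of at most |B| indices and treat each block separately. *)
Lemma disjoint_lincomb_le_mul (k : nat) (B F : {fset nat}) (b c : nat -> R)
    (t : R) :
  0 <= t -> [set` B] `<=` D -> [set` F] `<=` D ->
  (forall i, i \in F -> i \notin B) -> (#|` F| <= k * #|` B|)%N ->
  (forall i, i \in B -> t <= `|b i|) -> (forall i, i \in F -> `|c i| <= t) ->
  `|\sum_(i <- F) c i *: e i| <= k%:R * C * `|\sum_(i <- B) b i *: e i|.
Proof.
move=> t0 BD + + + bt; elim: k F => [|k IH] F FD dis card ct.
  move: card; rewrite leqn0 cardfs_eq0 => /eqP ->.
  by rewrite big_seq_fset0 normr0 !mul0r.
have [cF|/ltnW cF] := leqP #|` F| #|` B|.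
  apply: le_trans (disjoint_lincomb_le t0 BD FD dis cF bt ct) _.
  by rewrite -mulrA ler_peMl ?mulr_ge0 ?(ltW C0)// ler1n.
have [G [GF cG _]] := fset_largest (fun=> 0 : R) cF.
have /fsubsetP GF' := GF.
rewrite (sum_fsetID F G) (fsetIidPr GF) -natr1 addrC 2!mulrDl mul1r.
apply: le_trans (ler_normD _ _) _; apply: lerD.
  apply: IH => [i|i||i].
  - by rewrite /= inE => /andP[_ /FD].
  - by rewrite inE => /andP[_ /dis].
  - by rewrite cardfsDS// cG; lia.
  - by rewrite inE => /andP[_ /ct].
apply: (disjoint_lincomb_le (t := t)) => //.
- by move=> i /= /GF' /FD.
- by move=> i /GF' /dis.
- by rewrite cG.
- by move=> i /GF' /ct.
Qed.

(* Splitting [B] into its larger half and the rest lets [F] be compared with a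
   part of [B] that it does not meet. *)
Lemma lincomb_le_greedy (k : nat) : exists2 M : R, 0 <= M &
  forall (z : X) (B F : {fset nat}) (c : nat -> R) (t : R), 0 <= t ->
    greedy_set D es z B -> (forall i, i \in B -> t <= `|es i z|) ->
    [set` F] `<=` D -> (#|` F| <= k * #|` B|)%N ->
    (forall i, i \in F -> `|c i| <= t) ->
    `|\sum_(i <- F) c i *: e i| <= M * `|z|.
Proof.
have [b b0 hb] := basis_bounds hM.
have K0 : 0 <= C + 1 by rewrite addr_ge0// ltW.
(* With B1 the larger half of B, [M1] pays for F outside B1, as |F| <= k |B| <= 2k |B1|. [M2] pays
   for F inside B1, compared with B \ B1; its term [b * b] covers |B| <= 1, where B \ B1 is
   empty. *)
pose M1 := (2 * k)%:R * C * (C + 1).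
pose M2 := 2%:R * C * (C + 1 + (C + 1)) + b * b.
have M10 : 0 <= M1 by rewrite !mulr_ge0// ltW.
have M20 : 0 <= M2.
  by rewrite addr_ge0 ?mulr_ge0 ?addr_ge0// ltW.
exists (M1 + M2); first exact: addr_ge0.
move=> z B F c t t0 zB bt FD card ct.
have [BD Bmax] := zB.
have halves n : (uphalf n + n./2)%N = n.
  by rewrite uphalf_half -addnA addnn odd_double_half.
(* Taking the largest coefficients makes [B1] again a greedy set of z. *)
have [B1 [B1B cB1 B1max]] : exists B1 : {fset nat}, [/\ (B1 `<=` B)%fset,
    #|` B1| = uphalf #|` B| & forall i j, i \in B1 -> j \in B -> j \notin B1 ->
    `|es j z| <= `|es i z|].
  by apply: (fset_largest (fun i => `|es i z|)); rewrite -[leqRHS]halves leq_addr.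
have /fsubsetP B1B' := B1B.
have zB1 : greedy_set D es z B1.
  split=> [i /= /B1B' /BD//|i j iB1 Dj jB1].
  by have [jB|jB] := boolP (j \in B); [apply: B1max | apply: Bmax => //; apply: B1B'].
have cB2 : #|` (B `\` B1)%fset| = #|` B|./2 
  by rewrite cardfsDS// cB1 -[X in (X - _)%N]halves addKn.
rewrite (sum_fsetID F B1) addrC mulrDl.
apply: le_trans (ler_normD _ _) _; apply: lerD.
  apply: (@le_trans _ _ ((2 * k)%:R * C * `|Defs.proj e es B1 z|)); last first.
    by rewrite /M1 -[leRHS]mulrA ler_wpM2l ?mulr_ge0 ?(ltW C0)//; exact: greedy_proj_le.
  apply: (disjoint_lincomb_le_mul (t := t)) => // [i|i|i||i|i].
  - by move=> /= /B1B' /BD.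
  - by rewrite /= inE => /andP[_ /FD].
  - by rewrite inE => /andP[].
  - apply: leq_trans (fsubset_leq_card (fsubsetDl F B1)) (leq_trans card _).
    by rewrite [(2 * k)%N]mulnC -mulnA leq_mul2l cB1 mul2n -leq_uphalf_double leqnn
      orbT.
  - by move=> /B1B' /bt.
  - by rewrite inE => /andP[_ /ct].
have cFB1 : (#|` (F `&` B1)%fset| <= #|` B1|)%N.
  exact: fsubset_leq_card (fsubsetIr _ _).
(* In the first case |B| <= 1, so F meets B1 in at most one index, and that single term is at most
   |z_i| |e_i|. *)
have [B2|B2] := eqVneq #|` (B `\` B1)%fset| 0%N.
  have [->|/fset0Pn[i]] := eqVneq (F `&` B1)%fset fset0.
    by rewrite big_seq_fset0 normr0 mulr_ge0.
  rewrite inE => /andP[iF iB1].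
  have -> : (F `&` B1)%fset = [fset i]%fset.
    apply/esym/eqP; rewrite eqEfcard fsub1set inE iF iB1 cardfs1.
    by apply: leq_trans cFB1 _; rewrite cB1; move: B2; rewrite cB2; clear; lia.
  rewrite big_seq_fset1 normrZ.
  apply: (@le_trans _ _ (b * `|z| * b)); last first.
    by rewrite mulrAC ler_wpM2r// lerDr !mulr_ge0 ?addr_ge0// ltW.
  have [ei esi] := hb _ (FD _ iF).
  apply: ler_pM => //; apply: le_trans (esi z); apply: le_trans (ct _ iF) _.
  by apply: bt; apply: B1B'.
apply: (@le_trans _ _ (2%:R * C * `|Defs.proj e es (B `\` B1)%fset z|)); last first.
  rewrite /M2 [leRHS]mulrDl -[leLHS]addr0; apply: lerD; last by rewrite !mulr_ge0// ltW.
  rewrite -[leRHS]mulrA ler_wpM2l ?mulr_ge0 ?(ltW C0)//.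
  (* B \ B1 need not be a greedy set of z, but its projection is a difference of two greedy ones. *)
  have -> : Defs.proj e es (B `\` B1)%fset z = Defs.proj e es B z - Defs.proj e es B1 z.
    by rewrite /Defs.proj (sum_fsetID B B1) (fsetIidPr B1B) addrAC subrr add0r.
  by apply: le_trans (ler_normB _ _) _; rewrite mulrDl; apply: lerD; exact: greedy_proj_le.
apply: (disjoint_lincomb_le_mul (t := t)) => // [i|i|i||i|i].
- by rewrite /= inE => /andP[_ /BD].
- by rewrite /= inE => /andP[/FD].
- by rewrite !inE => /andP[_ ->].
(* |B1| <= |B \ B1| + 1 <= 2 |B \ B1|, as B \ B1 is nonempty. *)
- apply: leq_trans cFB1 _; move: B2; rewrite cB1 cB2 uphalf_half.
  by clear; case: (odd _); lia.
- by rewrite inE => /andP[_ /bt].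
- by rewrite inE => /andP[/ct].
Qed.

Lemma greedy_remainder_le_lincomb (lambda : R) : 0 <= lambda < 1 ->
  exists M : R, forall (x : X) (S A : {fset nat}) (a : nat -> R),
    greedy_set D es x S -> S != fset0 -> [set` A] `<=` D ->
    (#|` A| <= #|` S|)%N -> (#|` (A `&` S)%fset|)%:R <= lambda * (#|` S|)%:R ->
    `|x - Defs.proj e es S x| <= M * `|x - \sum_(i <- A) a i *: e i|.
Proof.
move=> /andP[l0 l1].
(* S \ A has at least (1 - lambda) |S| elements, so this k gives |A| <= |S| <= k |S \ A| <= k
   |B|. *)
have [k hk] : exists k : nat, 1 <= k%:R * (1 - lambda).
  exists (Num.bound (1 - lambda)^-1); rewrite -ler_pdivrMr ?subr_gt0// mul1r.
  by apply: ltW; apply: archi_boundP; rewrite invr_ge0 subr_ge0 ltW.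
have [M M0 hM'] := lincomb_le_greedy k.
(* [C] bounds the greedy remainder of z, and [M] each of the sums over A \ B and A \ S. *)
exists (C + M + M) => x S A a xS S0 AD cAS cI.
have [SD Smax] := xS.
set z := x - \sum_(i <- A) _.
have zc j : D j -> es j z = es j x - (if j \in A then a j else 0).
  by move=> Dj; rewrite linearB /= (coord_lincomb hM).
have [i0 i0S i0min] := fset_argmax (fun i => - `|es i x|) S0.
pose t := `|es i0 x|; have t0 : 0 <= t by exact: normr_ge0.
have tS i : i \in S -> t <= `|es i x| by move=> /i0min; rewrite lerN2.
have tN j : D j -> j \notin S -> `|es j x| <= t by apply: Smax.
pose Q := [fset i in A | t <= `|es i z|]%fset.
pose B := ((S `\` A) `|` Q)%fset.
have BE i : (i \in B) = (i \notin A) && (i \in S) || (i \in A) && (t <= `|es i z|).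
  by rewrite !inE.
have zx j : D j -> j \notin A -> es j z = es j x.
  by move=> Dj jA; rewrite zc// (negbTE jA) subr0.
have BD : [set` B] `<=` D.
  by move=> i /=; rewrite BE => /orP[/andP[_ /SD]|/andP[/AD]].
have tB i : i \in B -> t <= `|es i z|.
  move=> iB; move: (iB); rewrite BE => /orP[/andP[iA iS]|/andP[]//].
  by rewrite zx//; [exact: tS | exact: SD].
(* Off A the coordinates of z and x agree; on A, membership in B is decided by the threshold t. So t
   separates B from the rest. *)
have zB : greedy_set D es z B.
  split=> // i j iB Dj; rewrite BE negb_or !negb_and negbK -ltNge.
  move=> jB; apply: le_trans (tB _ iB); move: jB.
  have [jA|jA] /= := boolP (j \in A); first by move=> /ltW.
  by rewrite andbT zx//; exact: tN.
have cB : (#|` A| <= k * #|` B|)%N.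
  apply: leq_trans cAS _.
  rewrite -(ler_nat R) natrM.
  apply: (@le_trans _ _ (k%:R * (1 - lambda) * #|` S|%:R)).
    by rewrite ler_peMl.
  rewrite -mulrA ler_wpM2l// mulrBl mul1r.
  have SB : (#|` (S `\` A)%fset| <= #|` B|)%N by rewrite fsubset_leq_card ?fsubsetUl.
  rewrite lerBlDr; apply: (@le_trans _ _ (#|` (S `\` A)%fset|%:R + #|` (A `&` S)%fset|%:R)).
    by rewrite -natrD addnC fsetIC cardfsID.
  by apply: lerD => //; rewrite ler_nat.
(* Split S and B along A, and A along both. On B \ A = S \ A the coordinates of z and x agree, on A
   those of z are x_i - a_i, and the rest cancels. *)
have eqx : x - Defs.proj e es S x = z - Defs.proj e es B z
    - \sum_(i <- (A `\` B)%fset) es i z *: e i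
    + \sum_(i <- (A `\` S)%fset) es i x *: e i.
  have hS := sum_fsetID S A (fun i => es i x *: e i).
  have hB := sum_fsetID B A (fun i => es i z *: e i).
  have hAB := sum_fsetID A B (fun i => es i z *: e i).
  have hAS := sum_fsetID A S (fun i => es i x *: e i).
  have hA : \sum_(i <- A) es i z *: e i =
      \sum_(i <- A) es i x *: e i - \sum_(i <- A) a i *: e i.
    rewrite -sumrB; apply: eq_big_seq => i /= iA.
    by rewrite zc; [rewrite iA scalerBl | exact: AD].
  have hBA : \sum_(i <- (B `\` A)%fset) es i z *: e i =
      \sum_(i <- (S `\` A)%fset) es i x *: e i.
    have -> : (B `\` A)%fset = (S `\` A)%fset.
      apply/fsetP => i; rewrite in_fsetD BE in_fsetD.
      by case: (i \in A); rewrite /= ?orbF.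
    apply: eq_big_seq => i /=; rewrite inE => /andP[iA iS].
    by rewrite zx//; exact: SD.
  rewrite /Defs.proj hS hB hBA fsetIC [(B `&` A)%fset]fsetIC.
  rewrite hAB hAS in hA; rewrite /z.
  move: hA; set s1 := \sum_(i <- (A `&` S)%fset) _.
  set s2 := \sum_(i <- (S `\` A)%fset) _.
  set s3 := \sum_(i <- (A `&` B)%fset) _.
  set s4 := \sum_(i <- (A `\` B)%fset) _.
  set s5 := \sum_(i <- (A `\` S)%fset) _.
  set s6 := \sum_(i <- A) _ => /(canRL (addrK _)) ->.
  rewrite !opprD !opprK !addrA.
  by rewrite [RHS](ACl (1*3*7*2*5*6*8*9*4)) /= subrK !addrK.
rewrite eqx 2!mulrDl; apply: le_trans (ler_normD _ _) _; apply: lerD.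
  apply: le_trans (ler_normB _ _) _; apply: lerD; first exact: greedy_remainder_le.
  apply: (hM' _ B _ _ t) => // [i||i].
  - by rewrite /= inE => /andP[_ /AD].
  - by apply: leq_trans cB; rewrite fsubset_leq_card// fsubsetDl.
  - by rewrite inE BE => /andP[+ iA]; rewrite iA /= -ltNge => /ltW.
apply: (hM' _ B _ _ t) => // [i||i].
- by rewrite /= inE => /andP[_ /AD].
- by apply: leq_trans cB; rewrite fsubset_leq_card// fsubsetDl.
- by rewrite inE => /andP[iS iA]; apply: tN => //; exact: AD.
Qed.

End AlmostGreedyConsequences.

(** * Both implications, passing between greedy sets and orderings *)

Theorem theorem2p13 (R : realType) (X : completeNormedModType R)
    (D : set nat) (hD : index_set D)
    (e : nat -> X) (es : nat -> {linear X -> R^o})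
    (hM : bounded_markushevich_basis D e es) :
  almost_greedy D e es <->
  (forall lambda : R, 0 <= lambda < 1 ->
     exists C : R,
       forall (x : X) (rho : nat -> nat), greedy_ordering D es x rho ->
       forall m : nat, D m ->
       forall A : {fset nat}, [set` A] `<=` D -> (#|` A| <= m)%N ->
         (#|` (A `&` Lambda rho m)%fset|)%:R <= lambda * m%:R ->
       forall a : nat -> R,
         `|x - greedy_approx e es rho m x| <=
         C * `|x - \sum_(i <- A) a i *: e i|).
Proof.
rewrite (almost_greedyP hM hD); split=> [[C C0 hC] lambda hl|hb].
  have [M hM'] := greedy_remainder_le_lincomb hM C0 hC hl.
  exists M => x rho xrho m Dm A AD cA cI a.
  have cL : #|` Lambda rho m| = m.
    by have [_ inj _ _] := xrho; exact: (card_Lambda hD inj).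
  apply: hM' => //; rewrite ?cL//; first exact: Lambda_greedy_set xrho Dm.
  by rewrite -cardfs_gt0 cL (index_set_gt0 hD Dm).
have [|C hC] := hb 0; first by rewrite lexx ltr01.
exists (Num.max C 1); first by rewrite lt_max ltr01 orbT.
move=> x S A [SD Smax] AD cA.
have hS := sum_fsetID S A (fun i => es i x *: e i).
have hA := sum_fsetID A S (fun i => es i x *: e i).
(* Removing the common part first makes the competitor disjoint from the greedy set, as lambda = 0
   demands. *)
pose y := x - \sum_(i <- (A `&` S)%fset) es i x *: e i.
have ID : [set` (A `&` S)%fset] `<=` D by move=> i /=; rewrite inE => /andP[/AD].
have yc j : D j -> es j y = if j \in (A `&` S)%fset then 0 else es j x.
  move=> Dj; rewrite linearB /= (coord_lincomb hM)//.
  by case: ifP => _; rewrite ?subrr ?subr0.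
have eqA : x - Defs.proj e es A x = y - \sum_(i <- (A `\` S)%fset) es i x *: e i.
  by rewrite /Defs.proj hA opprD addrA.
have eqS : x - Defs.proj e es S x = y - Defs.proj e es (S `\` A)%fset y.
  rewrite /Defs.proj hS opprD addrA fsetIC; congr (_ - _).
  apply: eq_big_seq => i /=; rewrite inE => /andP[iA iS].
  by rewrite yc; [rewrite inE (negbTE iA) | exact: SD].
(* If S lies in A, then |A| <= |S| forces A = S and the constant 1 suffices; (b) does not apply to
   an empty greedy set. *)
have [S0|S0] := eqVneq (S `\` A)%fset fset0.
  have -> : A = S.
    by apply/esym/eqP; rewrite eqEfcard cA andbT -fsetD_eq0 S0.
  by rewrite ler_peMl// le_max lexx orbT.
(* The coordinates of y vanish on the common part and equal those of x elsewhere, so S \ A inherits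
   greediness from S. *)
have yS : greedy_set D es y (S `\` A)%fset.
  split=> [i /=|i j]; first by rewrite inE => /andP[_ /SD].
  rewrite !inE negb_and negbK => /andP[iA iS] Dj jSA.
  rewrite !yc//; last exact: SD.
  rewrite !inE (negbTE iA) /=; case: ifPn => [_|]; first by rewrite normr0.
  move: jSA; case: (boolP (j \in S)) => [_|jS _ _]; first by rewrite orbF andbT => ->.
  exact: Smax.
have [rho yrho rhoE] := greedy_set_ordering hM hD yS S0.
rewrite eqA eqS.
apply: (@le_trans _ _ (C * `|y - \sum_(i <- (A `\` S)%fset) es i x *: e i|));
  last first.
  by rewrite ler_wpM2r// le_max lexx.
rewrite -{1}rhoE; apply: hC => //.
- exact: (index_set_subset_card hD yS.1 S0).
- by move=> i /=; rewrite inE => /andP[_ /AD].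
- by rewrite !cardfsD [(S `&` A)%fset]fsetIC leq_sub2r.
- rewrite rhoE mul0r (_ : (_ `&` _)%fset = fset0) ?cardfs0//.
  by apply/fsetP => i; rewrite !inE; case: (i \in A); case: (i \in S).
Qed.
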